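(* Let $X=\{x_1,\ldots,x_N\}\subset\mathbb{R}^n$ and $Y=\{y_1,\ldots,y_N\}\subset\mathbb{R}^m$ be two point clouds of the same size. Let $c_1,c_2\in\mathbb{R}$ with $c_1\ne0$ and $c_2\ne0$. Let $X_{c_1}=\{c_1x_1,\ldots,c_1x_N\}$ be the point cloud with each point of $X$ scaled by $c_1$, and $Y_{c_2}=\{c_2y_1,\ldots,c_2y_N\}$ the point cloud with each point of $Y$ scaled by $c_2$. Then $\mathrm{GNSA}(X,Y)=\mathrm{GNSA}(X_{c_1},Y_{c_2})$.
   Context: A point cloud of size $N\ge 1$ in $\mathbb{R}^n$ is a family of points $x_1,\ldots,x_N\in\mathbb{R}^n$ indexed by $1,\ldots,N$. Two point clouds of the same size may lie in spaces of different dimensions. $d(\cdot,\cdot)$ is Euclidean distance. For point clouds $X=\{x_1,\ldots,x_N\}\subset\mathbb{R}^n$ and $Y=\{y_1,\ldots,y_N\}\subset\mathbb{R}^m$ of the same size, $$\mathrm{GNSA}(X,Y)=\frac1{N^2}\sum_{1\le i,j\le N}\left|\frac{d(x_i,x_j)}{\max_{x\in X}d(x,0)}-\frac{d(y_i,y_j)}{\max_{y\in Y}d(y,0)}\right|.$$ All point clouds are assumed to contain at least one nonzero point, so that the denominators are nonzero. *)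

(* Defs.v *)
From HB Require Import structures.
From mathcomp Require Import all_boot all_order all_algebra.
From mathcomp Require Import reals.

Set Implicit Arguments.
Unset Strict Implicit.
Unset Printing Implicit Defensive.

Import Order.TTheory GRing.Theory Num.Theory.
Local Open Scope ring_scope.

(* A family rather than a set: repeated points are allowed. *)
Definition point_cloud (R : realType) (n N : nat) : Type := 'I_N -> 'rV[R]_n.

(* The norm `|u - v| of mathcomp-analysis on 'rV[R]_n is the sup norm, hence
   this separate Euclidean distance. *)
Definition edist (R : realType) (n : nat) (u v : 'rV[R]_n) : R :=
  Num.sqrt (\sum_(k < n) (u 0 k - v 0 k) ^+ 2).

(* Distances are nonnegative, so for N >= 1 the initial value 0 of the iterated
   maximum does not affect the result. *)
Definition cloud_radius (R : realType) (n N : nat) (X : point_cloud R n N) : R :=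
  \big[Num.max/0]_(i < N) edist (X i) 0.

Definition GNSA (R : realType) (n m N : nat)
    (X : point_cloud R n N) (Y : point_cloud R m N) : R :=
  1 / N%:R ^+ 2 *
  \sum_(i < N) \sum_(j < N)
    `| edist (X i) (X j) / cloud_radius X - edist (Y i) (Y j) / cloud_radius Y |.

Definition scale_cloud (R : realType) (n N : nat) (c : R)
    (X : point_cloud R n N) : point_cloud R n N :=
  fun i => c *: X i.

(* Main.v *)
Require Import Defs.
From mathcomp Require Import all_boot all_order all_algebra.
From mathcomp Require Import reals.

Import Order.TTheory GRing.Theory Num.Theory.
Local Open Scope ring_scope.

(** Scaling a cloud by c multiplies all pairwise distances ([edistZ]) and the radius
    ([cloud_radiusZ]) by the same factor |c|, nonzero when c is. Each normalised distance is
    therefore unchanged ([edist_div_radiusZ]), and the two GNSA sums agree term by term. *)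

Lemma edistZ (R : realType) (n : nat) (c : R) (u v : 'rV[R]_n) :
  edist (c *: u) (c *: v) = `|c| * edist u v.
Proof.
rewrite /edist -sqrtr_sqr -sqrtrM ?sqr_ge0 // mulr_sumr.
by congr Num.sqrt; apply: eq_bigr => k _; rewrite !mxE -mulrBr exprMn.
Qed.

Lemma cloud_radiusZ (R : realType) (n N : nat) (c : R)
    (X : point_cloud R n N) :
  cloud_radius (scale_cloud c X) = `|c| * cloud_radius X.
Proof.
(* Multiplication by |c| >= 0 commutes with max and fixes the initial value 0, so it passes through
   the iterated maximum. *)
rewrite /cloud_radius (big_morph _ (fun x y => maxr_pMr x y (normr_ge0 c)) (mulr0 _)).
(* Scaling fixes the origin, so this is [edistZ] with second point [c *: 0]. *)
by apply: eq_bigr => i _; rewrite -edistZ scaler0.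
Qed.

Lemma edist_div_radiusZ (R : realType) (n N : nat) (c : R)
    (X : point_cloud R n N) (i j : 'I_N) : c != 0 ->
  edist (scale_cloud c X i) (scale_cloud c X j) / cloud_radius (scale_cloud c X)
  = edist (X i) (X j) / cloud_radius X.
Proof.
by move=> c0; rewrite edistZ cloud_radiusZ -mulf_div divff ?mul1r ?normr_eq0.
Qed.

Theorem lemmaB3 (R : realType) (n m N : nat)
    (X : point_cloud R n N) (Y : point_cloud R m N) (c1 c2 : R)
    (hN : (1 <= N)%N)
    (hX : exists i : 'I_N, X i != 0) (hY : exists i : 'I_N, Y i != 0)
    (hc1 : c1 != 0) (hc2 : c2 != 0) :
  GNSA X Y = GNSA (scale_cloud c1 X) (scale_cloud c2 Y).
Proof.
congr (_ * _); apply: eq_bigr => i _; apply: eq_bigr => j _.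
by rewrite !edist_div_radiusZ.
Qed.
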